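(* Let $F(A,b,\ell,u,c)$ be a linear program with $A\in\mathbb{R}^{V\times W}$, let $W_I\subseteq W$ be the set of integer variables, and let $(\mathcal P,\mathcal Q,\gamma,\lambda,\delta,V_U,W_U)$ be a reflection reduction of $F(A,b,\ell,u,c)$, with $\mathcal Q_I=\{Q\in\mathcal Q:Q\subseteq W_I\}$, $\Lambda=\mathrm{diag}(\lambda)$ and reduced data $A',b',\ell',u'$. If $\delta_w\in\mathbb{Z}$ for all $w\in W_I$ and if $\{w\}\in\mathcal Q$ for each $w\in W_I$, then $$\mathrm{conv}(\{x\in P(A,b,\ell,u) : (\Pi_{\mathcal Q}^{\top}\Lambda x_{W_U})_{\mathcal Q_I}\in\mathbb{Z}^{\mathcal Q_I}\})=\mathrm{conv}(P(A,b,\ell,u)\cap\mathbb{M}^{W_I}).$$ Additionally, for every $y\in P(A',b',\ell',u')\cap\mathbb{M}^{\mathcal Q_I}$, the point $x':=(\Lambda\widetilde{\Pi_{\mathcal Q}}y,\ 0_{W\setminus W_U})+\delta$ lies in $P(A,b,\ell,u)\cap\mathbb{M}^{W_I}$.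
   Context: $V$ and $W$ are disjoint finite sets; $b\in\mathbb{R}^V$, $c\in\mathbb{R}^W$, $\ell_w\in\mathbb{R}\cup\{-\infty\}$, $u_w\in\mathbb{R}\cup\{\infty\}$, $\ell\le u$. $F(A,b,\ell,u,c)$ denotes the linear program $\min\{c^{\top}x : Ax=b,\ \ell\le x\le u\}$ with feasible region $P(A,b,\ell,u)$. For an index set $S$ of some of the variables, $\mathbb{M}^{S}$ denotes the set of real vectors (on the full variable index set) whose coordinates indexed by $S$ are integers. A subscript set on a vector denotes restriction. Partition matrices: for a partition $\mathcal P$ of a set $S$, $\Pi_{\mathcal P}\in\{0,1\}^{S\times\mathcal P}$ has $(\Pi_{\mathcal P})_{s,P}=1$ iff $s\in P$; $\widetilde{\Pi_{\mathcal P}}$ has entries $1/|P|$ if $s\in P$ and $0$ otherwise. Reflection reduction. Let $V_U\subseteq V$, $W_U\subseteq W$, $W_B=W\setminus W_U$, $\mathcal P$ a partition of $V_U$, $\mathcal Q$ a partition of $W_U$, $\gamma\in\{-1,1\}^{V_U}$, $\lambda\in\{-1,1\}^{W_U}$, $\delta\in\mathbb{R}^W$ with $\ell\le\delta\le u$; $\Gamma=\mathrm{diag}(\gamma)$, $\Lambda=\mathrm{diag}(\lambda)$. For $w\in W_U$ let $\ell^{\lambda,\delta}_w=\ell_w-\delta_w$ and $u^{\lambda,\delta}_w=u_w-\delta_w$ if $\lambda_w=1$, and $\ell^{\lambda,\delta}_w=\delta_w-u_w$ and $u^{\lambda,\delta}_w=\delta_w-\ell_w$ if $\lambda_w=-1$.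 The reduced data are $A'=\Pi_{\mathcal P}^{\top}\Gamma A_{V_U,W_U}\Lambda\widetilde{\Pi_{\mathcal Q}}$, $b'=\Pi_{\mathcal P}^{\top}\Gamma(b-A\delta)_{V_U}$, $\ell'=\Pi_{\mathcal Q}^{\top}\ell^{\lambda,\delta}_{W_U}$, $u'=\Pi_{\mathcal Q}^{\top}u^{\lambda,\delta}_{W_U}$, $c'=\widetilde{\Pi_{\mathcal Q}}^{\top}\Lambda c_{W_U}$. Then $(\mathcal P,\mathcal Q,\gamma,\lambda,\delta,V_U,W_U)$ is a reflection reduction of $F(A,b,\ell,u,c)$ if: (i) for every $x\in P(A,b,\ell,u)$, $y:=\Pi_{\mathcal Q}^{\top}\Lambda(x_{W_U}-\delta_{W_U})$ lies in $P(A',b',\ell',u')$ and $c^{\top}x=c'^{\top}y+c^{\top}\delta$; (ii) for every $y\in P(A',b',\ell',u')$, $x:=(\Lambda\widetilde{\Pi_{\mathcal Q}}y+\delta_{W_U},\ \delta_{W_B})$ lies in $P(A,b,\ell,u)$ and $c'^{\top}y+c^{\top}\delta=c^{\top}x$. *)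

(* Defs.v *)
From HB Require Import structures.
From mathcomp Require Import all_boot all_order all_algebra.
From mathcomp Require Import all_classical all_reals all_analysis.

Set Implicit Arguments.
Unset Strict Implicit.
Unset Printing Implicit Defensive.

Import Order.TTheory GRing.Theory Num.Theory.

Local Open Scope classical_set_scope.
Local Open Scope ring_scope.

(* Constraints are indexed by V = 'I_m and variables by W = 'I_n.  A vector or
   matrix indexed by a subset or a family A of subsets has dimension #|A|, its
   i-th index standing for the element [enum_val i] of A. *)

Record linprog (R : realType) (m n : nat) := LinProg {
  lpA : 'M[R]_(m, n);
  lpb : 'cV[R]_m;
  lpl : 'I_n -> \bar R;
  lpu : 'I_n -> \bar R;
  lpc : 'cV[R]_n }.

Definition wf_bounds (R : realType) (m n : nat) (F : linprog R m n) : Prop :=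
  forall w, [/\ lpl F w != +oo%E, lpu F w != -oo%E
              & (lpl F w <= lpu F w)%E].

Definition feasible (R : realType) (m n : nat) (F : linprog R m n) :
    set 'cV[R]_n :=
  [set x | lpA F *m x = lpb F /\
           forall w, (lpl F w <= (x w 0%R)%:E <= lpu F w)%E].

(* \mathbb{M}^S *)
Definition mixed_int (R : realType) (n : nat) (S : {set 'I_n}) :
    set 'cV[R]_n :=
  [set x | forall w, w \in S -> x w 0 \is a Num.int].

Definition conv_hull (R : realType) (n : nat) (S : set 'cV[R]_n) :
    set 'cV[R]_n :=
  smallest (@convex_set R 'cV[R]_n) S.

(* x_S *)
Definition restr (T : Type) (n : nat) (S : {set 'I_n}) (x : 'cV[T]_n) :
    'cV[T]_#|S| :=
  rowsub enum_val x.

(* (z, x_{W \ S}) *)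
Definition splice (T : Type) (n : nat) (S : {set 'I_n}) (z : 'cV[T]_#|S|)
    (x : 'cV[T]_n) : 'cV[T]_n :=
  \col_w (if [pick i : 'I_#|S| | enum_val i == w] is Some i then z i 0
          else x w 0).

(* \Pi_P *)
Definition part_mx (R : realType) (n : nat) (S : {set 'I_n})
    (P : {set {set 'I_n}}) : 'M[R]_(#|S|, #|P|) :=
  \matrix_(i < #|S|, j < #|P|)
    (enum_val i \in (enum_val j : {set 'I_n}))%:R.

(* \widetilde{\Pi_P} *)
Definition npart_mx (R : realType) (n : nat) (S : {set 'I_n})
    (P : {set {set 'I_n}}) : 'M[R]_(#|S|, #|P|) :=
  \matrix_(i < #|S|, j < #|P|)
    ((enum_val i \in (enum_val j : {set 'I_n}))%:R
       / #|(enum_val j : {set 'I_n})|%:R).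

(* \Pi_P^T v for extended-real v; here 0 * -oo = 0 * +oo = 0. *)
Definition part_mxT_ext (R : realType) (n : nat) (S : {set 'I_n})
    (P : {set {set 'I_n}}) (v : 'I_#|S| -> \bar R) : 'I_#|P| -> \bar R :=
  fun j => (\sum_i (part_mx R S P i j)%:E * v i)%E.

Arguments part_mxT_ext {R n S} P v.

Definition refl_lower (R : realType) (n : nat) (WU : {set 'I_n})
    (l u : 'I_n -> \bar R) (lambda : 'rV[R]_#|WU|) (delta : 'cV[R]_n) :
    'I_#|WU| -> \bar R :=
  fun i => (let w := enum_val i in
            if lambda 0%R i == 1%R then l w - (delta w 0%R)%:E
            else (delta w 0%R)%:E - u w)%E.

Definition refl_upper (R : realType) (n : nat) (WU : {set 'I_n})
    (l u : 'I_n -> \bar R) (lambda : 'rV[R]_#|WU|) (delta : 'cV[R]_n) :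
    'I_#|WU| -> \bar R :=
  fun i => (let w := enum_val i in
            if lambda 0%R i == 1%R then u w - (delta w 0%R)%:E
            else (delta w 0%R)%:E - l w)%E.

Definition reduced_lp (R : realType) (m n : nat) (F : linprog R m n)
    (P : {set {set 'I_m}}) (Q : {set {set 'I_n}})
    (VU : {set 'I_m}) (WU : {set 'I_n})
    (gamma : 'rV[R]_#|VU|) (lambda : 'rV[R]_#|WU|) (delta : 'cV[R]_n) :
    linprog R #|P| #|Q| :=
  {| lpA := (part_mx R VU P)^T *m diag_mx gamma
              *m mxsub enum_val enum_val (lpA F)
              *m diag_mx lambda *m npart_mx R WU Q;
     lpb := (part_mx R VU P)^T *m diag_mx gamma
              *m restr VU (lpb F - lpA F *m delta);
     lpl := part_mxT_ext Q (refl_lower (lpl F) (lpu F) lambda delta);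
     lpu := part_mxT_ext Q (refl_upper (lpl F) (lpu F) lambda delta);
     lpc := (npart_mx R WU Q)^T *m diag_mx lambda *m restr WU (lpc F) |}.

Definition reflection_reduction (R : realType) (m n : nat)
    (F : linprog R m n)
    (P : {set {set 'I_m}}) (Q : {set {set 'I_n}})
    (VU : {set 'I_m}) (WU : {set 'I_n})
    (gamma : 'rV[R]_#|VU|) (lambda : 'rV[R]_#|WU|) (delta : 'cV[R]_n) :
    Prop :=
  let F' := reduced_lp F P Q gamma lambda delta in
  [/\ finset.partition P VU /\ finset.partition Q WU,
      (forall i, gamma 0 i = -1 \/ gamma 0 i = 1) /\
      (forall i, lambda 0 i = -1 \/ lambda 0 i = 1),
      (forall w, (lpl F w <= (delta w 0%R)%:E <= lpu F w)%E),
      (forall x, feasible F x ->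
         let y := (part_mx R WU Q)^T *m diag_mx lambda
                    *m (restr WU x - restr WU delta) in
         feasible F' y /\
         (lpc F)^T *m x = (lpc F')^T *m y + (lpc F)^T *m delta)
    & (forall y, feasible F' y ->
         let x := splice (diag_mx lambda *m npart_mx R WU Q *m y
                          + restr WU delta) delta in
         feasible F x /\
         (lpc F')^T *m y + (lpc F)^T *m delta = (lpc F)^T *m x)].

(* Q_I, as the set of indices of the variables of the reduced program that
   correspond to it. *)
Definition int_parts (n : nat) (Q : {set {set 'I_n}}) (WI : {set 'I_n}) :
    {set 'I_#|Q|} :=
  [set j : 'I_#|Q| | (enum_val j : {set 'I_n}) \subset WI]%SET.

(* Main.v *)
(* Since the singletons {w}, w in W_I, are blocks of the partition Q, they are
   exactly the blocks contained in W_I.  On such a block both Pi_Q^T Lambda and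
   Lambda Pi~_Q act as multiplication by the sign lambda_w, so they preserve
   and reflect integrality: the two sets whose convex hulls are compared are
   already equal. *)

Require Import Defs.
From HB Require Import structures.
From mathcomp Require Import all_boot all_order all_algebra.
From mathcomp Require Import all_classical all_reals all_analysis.

Set Implicit Arguments.
Unset Strict Implicit.
Unset Printing Implicit Defensive.

Import Order.TTheory GRing.Theory Num.Theory.

Local Open Scope classical_set_scope.
Local Open Scope ring_scope.

Lemma sign_mul_int (R : realType) (s x : R) :
  s = -1 \/ s = 1 -> (s * x \is a Num.int) = (x \is a Num.int).
Proof. by case=> ->; rewrite ?mul1r // mulN1r rpredN. Qed.

(** A block inside [WI] is nonempty, so it contains some [w] in [WI]; since [[set w]] is also a
    block and distinct blocks are disjoint, the two coincide. *)
Lemma int_parts_singleton (n : nat) (Q : {set {set 'I_n}})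
    (WU WI : {set 'I_n}) (j : 'I_#|Q|) :
  finset.partition Q WU -> (forall w, w \in WI -> [set w]%SET \in Q) ->
  j \in int_parts Q WI ->
  exists2 i : 'I_#|WU|, enum_val i \in WI & enum_val j = [set enum_val i]%SET.
Proof.
move=> /and3P[/eqP covQ trivQ Q0] Q_single; rewrite inE => jWI.
have jQ := enum_valP j.
have /set0Pn[w wj] : enum_val j != finset.set0.
  by apply: contraNneq Q0 => <-.
have wWI : w \in WI by apply: (fintype.subsetP jWI).
have wWU : w \in WU by rewrite -covQ; apply/bigcupP; exists (enum_val j).
exists (enum_rank_in wWU w); rewrite enum_rankK_in //.
rewrite -(def_pblock trivQ jQ wj).
by apply: def_pblock; rewrite ?Q_single ?set11.
Qed.

Lemma singleton_int_parts (n : nat) (Q : {set {set 'I_n}})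
    (WU WI : {set 'I_n}) (w : 'I_n) :
  finset.partition Q WU -> (forall w, w \in WI -> [set w]%SET \in Q) ->
  w \in WI ->
  exists i : 'I_#|WU|, exists2 j : 'I_#|Q|, j \in int_parts Q WI &
    enum_val i = w /\ enum_val j = [set enum_val i]%SET.
Proof.
move=> /and3P[/eqP covQ _ _] Q_single wWI; have wQ := Q_single w wWI.
have wWU : w \in WU.
  by rewrite -covQ; apply/bigcupP; exists [set w]%SET; rewrite ?set11.
exists (enum_rank_in wWU w), (enum_rank_in wQ [set w]%SET).
  by rewrite inE enum_rankK_in // finset.sub1set.
by rewrite !enum_rankK_in.
Qed.

(** Column [j] of $\Pi_Q$ is the indicator of a singleton, so only the term of [i] survives in the
    sum. *)
Lemma part_mx_singleton (R : realType) (n : nat) (Q : {set {set 'I_n}})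
    (WU : {set 'I_n}) (lambda : 'rV[R]_#|WU|) (v : 'cV[R]_#|WU|)
    (i : 'I_#|WU|) (j : 'I_#|Q|) :
  enum_val j = [set enum_val i]%SET ->
  ((part_mx R WU Q)^T *m diag_mx lambda *m v) j 0 = lambda 0 i * v i 0.
Proof.
move=> ij; rewrite -mulmxA mul_diag_mx !mxE (bigD1 i) //= !mxE ij set11 mul1r.
rewrite big1 ?addr0 // => k ki.
by rewrite !mxE ij finset.in_set1 (inj_eq enum_val_inj) (negbTE ki) mul0r.
Qed.

(** Row [i] of $\widetilde{\Pi_Q}$ has a single nonzero entry, at [j], because the blocks are
    disjoint; it equals 1 because block [j] has size 1. *)
Lemma npart_mx_singleton (R : realType) (n : nat) (Q : {set {set 'I_n}})
    (WU : {set 'I_n}) (lambda : 'rV[R]_#|WU|) (y : 'cV[R]_#|Q|)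
    (i : 'I_#|WU|) (j : 'I_#|Q|) :
  finset.trivIset Q -> enum_val j = [set enum_val i]%SET ->
  (diag_mx lambda *m npart_mx R WU Q *m y) i 0 = lambda 0 i * y j 0.
Proof.
move=> trivQ ij; rewrite -mulmxA mul_diag_mx !mxE; congr (_ * _).
rewrite (bigD1 j) //= !mxE ij set11 cards1 divr1 mul1r.
rewrite big1 ?addr0 // => k kj; rewrite !mxE.
have -> : (enum_val i \in (enum_val k : {set 'I_n})) = false.
  (* A block [k] containing the element of [i] must be the block of that element, which is [j]. *)
  apply: contraNF kj => ik; apply/eqP/enum_val_inj.
  rewrite -(def_pblock trivQ (enum_valP k) ik).
  by rewrite (def_pblock trivQ (enum_valP j)) // ij set11.
by rewrite !mul0r.
Qed.

Lemma splice_enum_val (T : Type) (n : nat) (S : {set 'I_n}) (z : 'cV[T]_#|S|)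
    (x : 'cV[T]_n) (i : 'I_#|S|) : splice z x (enum_val i) 0 = z i 0.
Proof.
rewrite mxE; case: pickP => [k /eqP/enum_val_inj -> //|/(_ i)].
by rewrite eqxx.
Qed.

(** Identifies the point $x'$ of the additional claim with the point that condition (ii) of a
    reflection reduction declares feasible. *)
Lemma spliceD (R : realType) (n : nat) (S : {set 'I_n}) (z : 'cV[R]_#|S|)
    (x : 'cV[R]_n) : splice z 0 + x = splice (z + restr S x) x.
Proof.
apply/matrixP => w k; rewrite (ord1 k) !mxE.
case: pickP => [i /eqP <-|_]; last by rewrite add0r.
by rewrite !mxE.
Qed.

(** Blocks inside [WI] correspond to elements of [WI], and corresponding coordinates differ only by
    a sign. *)
Lemma mixed_int_reduced (R : realType) (n : nat) (Q : {set {set 'I_n}})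
    (WU WI : {set 'I_n}) (lambda : 'rV[R]_#|WU|) (x : 'cV[R]_n) :
  finset.partition Q WU -> (forall w, w \in WI -> [set w]%SET \in Q) ->
  (forall i, lambda 0 i = -1 \/ lambda 0 i = 1) ->
  mixed_int (int_parts Q WI)
    ((part_mx R WU Q)^T *m diag_mx lambda *m restr WU x) <-> mixed_int WI x.
Proof.
move=> partQ Q_single sgn; split=> x_int.
  move=> _ /(singleton_int_parts partQ Q_single)[i [j jI [<- ij]]].
  by have := x_int j jI; rewrite (part_mx_singleton _ _ ij) sign_mul_int // mxE.
move=> j /(int_parts_singleton partQ Q_single)[i iWI ij].
by rewrite (part_mx_singleton _ _ ij) sign_mul_int // mxE; apply: x_int.
Qed.

Theorem lemma28 (R : realType) (m n : nat) (F : linprog R m n)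
    (WI : {set 'I_n})
    (P : {set {set 'I_m}}) (Q : {set {set 'I_n}})
    (VU : {set 'I_m}) (WU : {set 'I_n})
    (gamma : 'rV[R]_#|VU|) (lambda : 'rV[R]_#|WU|) (delta : 'cV[R]_n)
    (F_wf : wf_bounds F)
    (F_red : reflection_reduction F P Q gamma lambda delta)
    (delta_int : forall w, w \in WI -> delta w 0 \is a Num.int)
    (Q_single : forall w, w \in WI -> [set w]%SET \in Q) :
  conv_hull [set x | feasible F x /\
                     mixed_int (int_parts Q WI)
                       ((part_mx R WU Q)^T *m diag_mx lambda *m restr WU x)]
    = conv_hull (feasible F `&` mixed_int WI) /\
  (forall y, (feasible (reduced_lp F P Q gamma lambda delta)
                `&` mixed_int (int_parts Q WI)) y ->
     (feasible F `&` mixed_int WI)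
       (splice (diag_mx lambda *m npart_mx R WU Q *m y) 0 + delta)).
Proof.
case: F_red => [[_ partQ] [_ sgn] _ _ lift]; split.
  congr conv_hull; apply/seteqP.
  by split=> x [Fx /(mixed_int_reduced _ partQ Q_single sgn)].
move=> y [F'y y_int]; split; first by rewrite spliceD; apply: (lift y F'y).1.
move=> w wWI.
have [i [j jI [iw ij]]] := singleton_int_parts partQ Q_single wWI.
(* Coordinate [w] of $x'$ is $\lambda_i y_j + \delta_w$, so only the integrality of $\lambda_i y_j$
   remains. *)
rewrite mxE rpredD ?delta_int // -iw splice_enum_val.
case/and3P: partQ => _ trivQ _.
by rewrite (npart_mx_singleton _ _ trivQ ij) sign_mul_int ?y_int.
Qed.
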